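(* Let $\mathcal S=S_{\boldsymbol\lambda}F_1\otimes S_{\boldsymbol\mu}F_3^*$ be a decoration (of a licci ideal of codimension 3), with $\boldsymbol\lambda=(\lambda_1\ge\lambda_2\ge\cdots)$, $\boldsymbol\mu=(\mu_1\ge\mu_2\ge\cdots)$ and $k=\sum_j\mu_j$. Then: (1) $\lambda_1+\lambda_2\le k+1$. (2) $\mu_1+\lambda_1+\lambda_2>k+1$. (3) $\sum_{i\ge1}\lambda_i^2+\sum_{j\ge1}\mu_j^2=(k+1)^2$. (4) $\lambda_1+\mu_1\le k+1$.
   Context: Partitions are regarded as infinite non-increasing sequences of nonnegative integers with trailing zeros. For a pair of partitions $(\boldsymbol\lambda,\boldsymbol\mu)$, also written $S_{\boldsymbol\lambda}F_1\otimes S_{\boldsymbol\mu}F_3^*$, put $k=\sum\mu_i$. A link of the pair (in codimension 3) is obtained as follows: choose a three-element sublist $\boldsymbol\lambda'=(\lambda_1'\ge\lambda_2'\ge\lambda_3')$ of the infinite list $\boldsymbol\lambda$ (zeros allowed), let $\boldsymbol\lambda''$ be the remaining list, put $p=k+1-\lambda_1'-\lambda_2'-\lambda_3'$, and form the pair whose first partition is $(\lambda_1'+p,\lambda_2'+p,\lambda_3'+p,\mu_1,\mu_2,\ldots)$ sorted in non-increasing order and whose second partition is $\boldsymbol\lambda''$. The decorations are exactly the pairs obtained from the pair $((1),(0))$ of the unit ideal by finitely many links; decorations of licci ideals of codimension 3 are those different from $((1),(0))$. (They satisfy $\sum\lambda_i=2k+1$ and index the vertices $\ne\mathrm{id}$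 of the graph $\mathrm{Licci}_3$, i.e. the Herzog classes of licci ideals of codimension 3.) *)

(* Defs.v *)
From mathcomp Require Import all_boot all_order all_algebra.

Set Implicit Arguments.
Unset Strict Implicit.
Unset Printing Implicit Defensive.

(* A partition, as an infinite non-increasing sequence with trailing zeros, is
   encoded by the list of its nonzero terms in non-increasing order. *)

(* The i-th largest term, for i >= 1: [part s 1] is the largest. *)
Definition part (s : seq nat) (i : nat) : nat := nth 0 s i.-1.

(* Non-increasing rearrangement, in normal form (without the zeros). *)
Definition to_partition (s : seq nat) : seq nat :=
  sort geq [seq x <- s | x != 0].

(* A three-element sublist of the infinite sequence uses at most three of the
   trailing zeros, so three zeros of padding give all possible choices. *)
Definition pad3 (s : seq nat) : seq nat := s ++ nseq 3 0.

(* [link d e]: e is a link of d = (lambda, mu). The mask m chooses lambda' and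
   leaves lambda''. The integer p may be negative, so the shifted terms
   lambda'_i + p are computed in int; they are the entries of s, a list of
   natural numbers because the linked pair consists of partitions. *)
Definition link (d e : seq nat * seq nat) : Prop :=
  exists (m : bitseq) (s : seq nat),
    let: (lambda, mu) := d in
    let lambda' := mask m (pad3 lambda) in
    let lambda'' := mask (map negb m) (pad3 lambda) in
    let k := \sum_(x <- mu) x in
    let p : int := (k%:Z + 1 - (\sum_(x <- lambda') x)%:Z)%R in
    [/\ size m = size (pad3 lambda),
        size lambda' = 3,
        [seq x%:Z%R | x <- s] = [seq (x%:Z + p)%R | x <- lambda'] &
        e = (to_partition (s ++ mu), to_partition lambda'')].

Definition unit_pair : seq nat * seq nat := ([:: 1], [::]).

Inductive decoration : seq nat * seq nat -> Prop :=
| decoration_unit : decoration unit_pair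
| decoration_link d e : decoration d -> link d e -> decoration e.

Definition licci_decoration (d : seq nat * seq nat) : Prop :=
  decoration d /\ d <> unit_pair.

(* Main.v *)
Require Import Defs.
From mathcomp Require Import all_boot all_order all_algebra.
From mathcomp Require Import zify ring lra.

(** With [d = k + 1] and [m] the concatenation of [lambda] and [mu], regard
    [(d; m)] as the class [d H - \sum_i m_i E_i] on a blow-up of the plane. A
    link is a quadratic Cremona transformation centred at three entries of
    [lambda], so it preserves the self-intersection [d^2 - \sum_i m_i^2], which
    is [0] for the unit pair: this is (3).
    Call [(e; n)] exceptional if [e >= 0], its square is [-1] and
    [3 e - \sum_i n_i = 1]. By Cauchy-Schwarz and integrality, Cremona
    transformations preserve exceptional classes; they are isometries, hence
    they also preserve the property of meeting every exceptional class
    non-negatively. The pencil of lines [(1; 1)] has this property, so every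
    decoration has it. Testing against the lines [(1; 1, 1)] gives (1) and (4).
    Finally (2) follows from (1), (3) and the sums [2 k + 1] and [k], by
    bounding the squares of the terms by multiples of the terms. *)

Set Implicit Arguments.
Unset Strict Implicit.
Unset Printing Implicit Defensive.

Import Order.TTheory GRing.Theory Num.Theory.

(** * Rearrangements of lists and their zero entries *)

Lemma perm_mask_negb (T : eqType) (m : bitseq) (s : seq T) :
  size m = size s -> perm_eq (mask m s ++ mask (map negb m) s) s.
Proof.
elim: m s => [|b m IHm] [|x s] //= [/IHm perm_s].
by case: b => /=; rewrite ?perm_cons // -cat1s perm_catCA /= perm_cons.
Qed.

Lemma perm_map_lift (T U : eqType) (f : T -> U) (z : seq T) (s : seq U) :
  perm_eq (map f z) s -> exists2 z', perm_eq z z' & map f z' = s.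
Proof.
elim: s z => [|a s IHs] z perm_zs.
  by exists [::] => //; move/perm_size: perm_zs; rewrite size_map; case: z.
have /mapP[x xz def_a] : a \in map f z by rewrite (perm_mem perm_zs) mem_head.
have perm_z := perm_to_rem xz.
move: (perm_map f perm_z); rewrite /= -def_a perm_sym => perm_fz.
have := perm_trans perm_fz perm_zs; rewrite perm_cons => /IHs[z' perm_z' <-].
exists (x :: z'); last by rewrite /= def_a.
by rewrite (perm_trans perm_z) // perm_cons.
Qed.

Definition nonzeros (s : seq nat) : seq nat := [seq x <- s | x != 0].

Lemma nonzeros_cat s t : nonzeros (s ++ t) = nonzeros s ++ nonzeros t.
Proof. exact: filter_cat. Qed.

Lemma nonzeros_nseq0 n : nonzeros (nseq n 0) = [::].
Proof. by elim: n. Qed.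

Lemma perm_nonzeros s : perm_eq s (nonzeros s ++ nseq (count_mem 0 s) 0).
Proof.
elim: s => //= -[|x] s IHs; rewrite ?perm_cons //=.
rewrite -(cat1s 0) -(cat1s 0 (nseq _ _)) perm_sym perm_catCA.
by rewrite perm_sym perm_cons.
Qed.

Lemma perm_to_partition s : perm_eq (to_partition s) (nonzeros s).
Proof. by rewrite perm_sort. Qed.

Lemma sorted_to_partition s : sorted geq (to_partition s).
Proof. by apply: sort_sorted => x y; exact: leq_total. Qed.

Lemma nonzeros_to_partition s : nonzeros (to_partition s) = to_partition s.
Proof. by apply/all_filterP; rewrite all_sort filter_all. Qed.

Lemma sum_nonzeros (F : nat -> nat) s :
  F 0 = 0 -> \sum_(x <- nonzeros s) F x = \sum_(x <- s) F x.
Proof.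
move=> F0; rewrite (perm_big _ (perm_nonzeros s)) big_cat /=.
by rewrite [X in _ + X]big1_seq ?addn0 // => x /andP[_ /nseqP[-> _]].
Qed.

Lemma sum_to_partition (F : nat -> nat) s :
  F 0 = 0 -> \sum_(x <- to_partition s) F x = \sum_(x <- s) F x.
Proof.
by move=> F0; rewrite (perm_big _ (perm_to_partition s)) sum_nonzeros.
Qed.

(** * Nef classes and quadratic Cremona transformations *)

Section Nef.
Local Open Scope ring_scope.

(* An entry [(m, n)] of [z] pairs the multiplicities of two classes at the same
   point. *)
Definition pairing (z : seq (nat * int)) : int := \sum_(x <- z) x.1%:Z * x.2.
Definition total (z : seq (nat * int)) : int := \sum_(x <- z) x.2.
Definition sqtotal (z : seq (nat * int)) : int := \sum_(x <- z) x.2 ^+ 2.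

Lemma pairing_cons m n z : pairing ((m, n) :: z) = m%:Z * n + pairing z.
Proof. exact: big_cons. Qed.

Lemma total_cons m n z : total ((m, n) :: z) = n + total z.
Proof. exact: big_cons. Qed.

Lemma sqtotal_cons m n z : sqtotal ((m, n) :: z) = n ^+ 2 + sqtotal z.
Proof. exact: big_cons. Qed.

Definition consE := (pairing_cons, total_cons, sqtotal_cons).

Definition exceptional (e : int) (z : seq (nat * int)) : Prop :=
  [/\ 0 <= e, sqtotal z = e ^+ 2 + 1 & total z = 3 * e - 1].

(** Comparing only [nonzeros] lets a test class have further points, at which [s] has multiplicity
    0. *)
Definition nef (d : int) (s : seq nat) : Prop :=
  forall e z, perm_eq (nonzeros (unzip1 z)) (nonzeros s) ->
    exceptional e z -> pairing z <= d * e.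

Lemma perm_nef d s t :
  perm_eq (nonzeros s) (nonzeros t) -> nef d s -> nef d t.
Proof.
by move=> perm_st nef_s e z perm_z; apply: nef_s; rewrite (permPr perm_st).
Qed.

Lemma sum_cat_zeros (F : nat * int -> int) z n :
  F (0%N, 0) = 0 -> \sum_(x <- z ++ nseq n (0%N, 0)) F x = \sum_(x <- z) F x.
Proof.
move=> F0; rewrite big_cat /= [X in _ + X]big1_seq ?addr0 //.
by move=> x /andP[_ /nseqP[-> _]].
Qed.

(* A class may be padded with zeros, so [z] may be assumed to list the entries
   of [s] first, in order. *)
Lemma nefP d s :
  (forall e z j, unzip1 z = s ++ nseq j 0%N -> exceptional e z ->
     pairing z <= d * e) -> nef d s.
Proof.
move=> nef_s e z perm_z [e_ge0 sqr_z sum_z].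
(* Each list receives as many zeros as the other contains, so that the multiplicities agree as
   multisets. *)
set z0 := z ++ nseq (count_mem 0%N s) (0%N, 0).
have [|z1 perm_z1 def_z1] := @perm_map_lift _ _ fst z0
  (s ++ nseq (count_mem 0%N (unzip1 z)) 0%N).
  rewrite map_cat map_nseq /=.
  rewrite (permPl (perm_cat (perm_nonzeros _) (perm_refl _))).
  rewrite perm_sym (permPl (perm_cat (perm_nonzeros _) (perm_refl _))) perm_sym.
  by rewrite -!catA perm_cat // perm_catC.
have sumE (F : nat * int -> int) : F (0%N, 0) = 0 ->
    \sum_(x <- z1) F x = \sum_(x <- z) F x.
  by move=> F0; rewrite -(perm_big _ perm_z1) sum_cat_zeros.
rewrite /pairing -sumE //; apply: nef_s def_z1 _.
by split; rewrite ?/total ?/sqtotal ?sumE.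
Qed.

(** Integrality enters here: [n ^+ 2 + n] is non-negative for every integer [n]. *)
Lemma sum_sqr_ge (z : seq (nat * int)) :
  0 <= sqtotal z /\ - total z <= sqtotal z.
Proof.
elim: z => [|[m n] z [IH0 IH1]]; first by rewrite /sqtotal /total !big_nil.
rewrite !consE.
have sqr_n : - n <= n ^+ 2 by have [|] := leP 0 n; nia.
by split; [exact: addr_ge0 (sqr_ge0 n) IH0 | rewrite opprD lerD].
Qed.

Lemma sum_unzip1_0 (z : seq (nat * int)) j :
  unzip1 z = nseq j 0%N -> pairing z = 0.
Proof.
move=> def_z; apply: big1_seq => x /andP[_ /(map_f fst)].
by rewrite -/(unzip1 z) def_z => /nseqP[-> _]; rewrite mul0r.
Qed.

Lemma nef_pencil : nef 1 [:: 1%N].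
Proof.
apply: nefP => e [|[m n] z] j //= [-> def_z] [e_ge0].
rewrite !consE (sum_unzip1_0 def_z) => sqr_z sum_z.
have [sqz_ge0 sqz_ge] := sum_sqr_ge z.
have [|lt_en] := leP n e; first lia.
have : (e + 1) ^+ 2 <= n ^+ 2 by rewrite ler_sqr ?nnegrE; lia.
rewrite sqrrD1 -mulr_natr => le_en.
(* Here [(e + 1) ^+ 2 <= n ^+ 2 <= e ^+ 2 + 1]. Once [e = 0], the total of [z] is at most -2 and its
   square total at most 0, against [sqz_ge]. *)
have e0 : e = 0 by lia.
by subst e; lia.
Qed.

(** The two equations are preserved by direct expansion; the work lies in showing that the new
    degree is non-negative. *)
Lemma exceptional_cremona e a1 a2 a3 b1 b2 b3 n1 n2 n3 z :
  exceptional e [:: (b1, n1), (b2, n2), (b3, n3) & z] ->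
  exceptional (2 * e - n1 - n2 - n3)
    [:: (a1, e - n2 - n3), (a2, e - n1 - n3), (a3, e - n1 - n2) & z].
Proof.
case; rewrite !consE => e_ge0 sqr_z sum_z.
have [sqz_ge0 sqz_ge] := sum_sqr_ge z.
split; rewrite ?consE; [| by lra | by lra].
have := (sqr_ge0 n1, sqr_ge0 n2, sqr_ge0 n3) => -[[sqr1 sqr2] sqr3].
have [e0|e_neq0] := eqVneq e 0; first by move: sqr_z sum_z; rewrite e0; lra.
have cauchy : (n1 + n2 + n3) ^+ 2 <= 3 * (e ^+ 2 + 1).
  have : 0 <= (n1 - n2) ^+ 2 + (n1 - n3) ^+ 2 + (n2 - n3) ^+ 2.
    by rewrite !addr_ge0 ?sqr_ge0.
  by lra.
have [|lt_en] := leP (n1 + n2 + n3) (2 * e); first by lra.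
(* With [cauchy] this gives [e ^+ 2 + 4 * e <= 2], impossible for [e >= 1]. *)
have : (2 * e + 1) ^+ 2 <= (n1 + n2 + n3) ^+ 2 by rewrite ler_sqr ?nnegrE; lia.
have e_ge1 : 1 <= e by lia.
by have := sqr_ge0 e; lra.
Qed.

Lemma cremona_sqr (d a1 a2 a3 b1 b2 b3 d' : int) :
  b1 = d - a2 - a3 -> b2 = d - a1 - a3 -> b3 = d - a1 - a2 ->
  d' = 2 * d - a1 - a2 - a3 ->
  b1 ^+ 2 + b2 ^+ 2 + b3 ^+ 2 + d ^+ 2 = a1 ^+ 2 + a2 ^+ 2 + a3 ^+ 2 + d' ^+ 2.
Proof. by move=> -> -> -> ->; ring. Qed.

(** The transformation is an isometric involution, so it can be moved from the class to the test
    class. *)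
Lemma nef_cremona d (a1 a2 a3 b1 b2 b3 : nat) r :
  b1%:Z = d - a2%:Z - a3%:Z -> b2%:Z = d - a1%:Z - a3%:Z ->
  b3%:Z = d - a1%:Z - a2%:Z ->
  nef d [:: a1, a2, a3 & r] ->
  nef (2 * d - a1%:Z - a2%:Z - a3%:Z) [:: b1, b2, b3 & r].
Proof.
move=> def_b1 def_b2 def_b3 nef_a.
apply: nefP => e [|[? n1] [|[? n2] [|[? n3] z]]] j //= [-> -> ->] def_z exc_z.
have := nef_a _ _ _ (exceptional_cremona a1 a2 a3 exc_z).
rewrite !consE def_b1 def_b2 def_b3 => nef_z.
suff /nef_z : perm_eq (nonzeros [:: a1, a2, a3 & unzip1 z])
                      (nonzeros [:: a1, a2, a3 & r]) by lra.
rewrite def_z -[[:: a1, a2, a3 & r ++ _]]/([:: a1, a2, a3 & r] ++ _).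
by rewrite nonzeros_cat nonzeros_nseq0 cats0.
Qed.

Lemma nef_line d x y r : nef d [:: x, y & r] -> x%:Z + y%:Z <= d.
Proof.
move=> nef_xy; pose z := [seq (v, 0 : int) | v <- r].
have [pair0 tot0 sq0] : [/\ pairing z = 0, total z = 0 & sqtotal z = 0].
  by split; apply: big1_seq => u /mapP[v _ ->] //=; rewrite mulr0.
have := nef_xy 1 [:: (x, 1), (y, 1) & z].
rewrite /exceptional !consE pair0 tot0 sq0 !mulr1 !addr0; apply=> //=.
by rewrite -[unzip1 z]map_comp map_id.
Qed.

End Nef.

(** For [d = k + 1], the sum condition implies that all the multiplicities add up to [3 * d - 2], as
    for the pencil of lines. *)
Record decoration_invariant (lambda mu : seq nat) : Prop :=
    DecorationInvariant {
  _ : sorted geq lambda;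
  _ : sorted geq mu;
  _ : nonzeros lambda = lambda;
  _ : nonzeros mu = mu;
  _ : \sum_(x <- lambda) x = 2 * (\sum_(x <- mu) x) + 1;
  _ : \sum_(x <- lambda) x ^ 2 + \sum_(x <- mu) x ^ 2
      = (\sum_(x <- mu) x + 1) ^ 2;
  _ : nef (Posz (\sum_(x <- mu) x + 1)) (lambda ++ mu)
}.

Lemma decoration_invariant_unit : decoration_invariant [:: 1] [::].
Proof. by split; rewrite ?big_cons ?big_nil //; apply: nef_pencil. Qed.

(** Since [a1 + p = k + 1 - a2 - a3], and likewise for the others, the shift is the Cremona formula
    in degree [k + 1]. The sum condition identifies the transformed degree with the new [k + 1]. *)
Lemma decoration_invariant_link lambda mu lambda1 mu1 :
  decoration_invariant lambda mu -> link (lambda, mu) (lambda1, mu1) ->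
  decoration_invariant lambda1 mu1.
Proof.
move=> [_ _ _ _ sum_l sqr_l nef_d] [m [s [size_m size_l' def_s [-> ->]]]].
have := perm_mask_negb size_m.
move: size_l' def_s; set l'' := mask (map negb m) _.
case: (mask m _) => [|a1 [|a2 [|a3 [|? ?]]]] //= _.
case: s => [|b1 [|b2 [|b3 [|? ?]]]] //=.
rewrite !big_cons big_nil addn0 => -[def_b1 def_b2 def_b3] perm_l.
have sumE (F : nat -> nat) : F 0 = 0 ->
    F a1 + (F a2 + (F a3 + \sum_(x <- l'') F x)) = \sum_(x <- lambda) F x.
  move=> F0; transitivity (\sum_(x <- pad3 lambda) F x).
    by rewrite -(perm_big _ perm_l) !big_cons.
  by rewrite /pad3 big_cat /= !big_cons big_nil F0 !addn0.
have sum_l'' := sumE id (erefl 0).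
have sqr_l'' := sumE (expn^~ 2) (erefl 0).
rewrite sum_l in sum_l''.
rewrite -sqr_l'' in sqr_l.
split; rewrite ?sorted_to_partition ?nonzeros_to_partition //.
- rewrite !sum_to_partition //= !big_cons.
  move: (\sum_(x <- l'') x) (\sum_(x <- mu) x) sum_l'' def_b1 def_b2 def_b3.
  by lia.
- rewrite !sum_to_partition //= !big_cons.
  move: (\sum_(x <- l'') x) (\sum_(x <- mu) x) sum_l'' sqr_l
    def_b1 def_b2 def_b3.
  move: (\sum_(x <- l'') x ^ 2) (\sum_(x <- mu) x ^ 2).
  move=> q'' q t k sum_l'' sqr_l' def_b1 def_b2 def_b3.
  have := @cremona_sqr (k + 1)%N a1 a2 a3 b1 b2 b3 (t + 1)%N.
  by lia.
- rewrite sum_to_partition //.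
  have -> : Posz (\sum_(x <- l'') x + 1)
      = (2 * (\sum_(x <- mu) x + 1)%N%:Z - a1%:Z - a2%:Z - a3%:Z)%R by lia.
  apply: (@perm_nef _ [:: b1, b2, b3 & mu ++ l'']).
    rewrite nonzeros_cat !nonzeros_to_partition.
    rewrite -[_ :: _]/([:: b1, b2, b3 & mu] ++ l'').
    by rewrite nonzeros_cat perm_sym perm_cat ?perm_to_partition.
  apply: nef_cremona; try lia.
  apply: perm_nef nef_d.
  rewrite -[_ :: _]/([:: a1; a2; a3] ++ mu ++ l'').
  have : perm_eq (nonzeros (pad3 lambda)) (nonzeros ([:: a1; a2; a3] ++ l'')).
    by rewrite perm_sym perm_filter.
  rewrite /pad3 nonzeros_cat nonzeros_nseq0 cats0 => perm_l'.
  rewrite nonzeros_cat (permPl (perm_cat perm_l' (perm_refl _))).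
  by rewrite -nonzeros_cat perm_filter // -catA perm_cat2l perm_catC.
Qed.

Lemma decorationP lambda mu :
  decoration (lambda, mu) -> decoration_invariant lambda mu.
Proof.
move def_d: (lambda, mu) => d dec_d.
elim: dec_d lambda mu def_d => [|[l m] e _ IHd link_e] lambda mu.
  by case=> -> ->; apply: decoration_invariant_unit.
move=> def_e; rewrite -def_e in link_e.
exact: decoration_invariant_link (IHd _ _ (erefl _)) link_e.
Qed.

(** * Numerical consequences of the invariant *)

Lemma nef_part12 d s t :
  nef d (s ++ t) -> (Posz (part s 1 + part s 2) <= d)%R.
Proof.
move=> nef_st; apply: (@nef_line _ _ _ (drop 2 s ++ t)); apply: perm_nef nef_st.
by case: s => [|a [|b s]] //=; rewrite drop0.
Qed.

Lemma nef_part11 d s t :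
  nef d (s ++ t) -> (Posz (part s 1 + part t 1) <= d)%R.
Proof.
move=> nef_st; apply: (@nef_line _ _ _ (behead s ++ behead t)).
apply: perm_nef nef_st; case: s t => [|a s] [|b t] //.
by apply: perm_filter; rewrite /= perm_cons -cat1s perm_catCA.
Qed.

Lemma sum_sqr_le c s :
  all (geq c) s -> \sum_(x <- s) x ^ 2 <= c * \sum_(x <- s) x.
Proof.
move=> /allP le_sc; rewrite big_distrr /= !big_seq leq_sum // => x /le_sc le_xc.
by rewrite -mulnn leq_mul2r [x <= c]le_xc orbT.
Qed.

Lemma sorted_all_geq c s : sorted geq (c :: s) -> all (geq c) s.
Proof. by apply: order_path_min => x y z le_xy /leq_trans; apply. Qed.

Lemma sum_sqr_le_part1 s :
  sorted geq s -> \sum_(x <- s) x ^ 2 <= part s 1 * \sum_(x <- s) x.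
Proof.
case: s => [|a s] sorted_s; first by rewrite !big_nil.
by apply: sum_sqr_le; rewrite /= leqnn sorted_all_geq.
Qed.

(** The square of the first term is kept exact; only the later terms are bounded by [part s 2]. *)
Lemma sum_sqr_le_part12 s : sorted geq s ->
  \sum_(x <- s) x ^ 2 + part s 1 * part s 2
    <= part s 1 ^ 2 + part s 2 * \sum_(x <- s) x.
Proof.
case: s => [|a s] sorted_s; first by rewrite !big_nil.
have := sum_sqr_le_part1 (path_sorted sorted_s).
by rewrite /part !big_cons /= mulnDr; lia.
Qed.

Theorem proposition5p1 (lambda mu : seq nat) (k : nat)
    (hk : k = \sum_(x <- mu) x)
    (hdec : licci_decoration (lambda, mu)) :
  [/\ part lambda 1 + part lambda 2 <= k + 1,
      part mu 1 + part lambda 1 + part lambda 2 > k + 1,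
      \sum_(x <- lambda) x ^ 2 + \sum_(x <- mu) x ^ 2 = (k + 1) ^ 2 &
      part lambda 1 + part mu 1 <= k + 1].
Proof.
case: hdec => /decorationP inv not_unit.
case: inv => [sort_l sort_m nz_l nz_m sum_l sqr_lm nef_lm].
rewrite -hk in sum_l sqr_lm nef_lm.
have part12 : part lambda 1 + part lambda 2 <= k + 1 := nef_part12 nef_lm.
split=> //; last exact: nef_part11 nef_lm.
rewrite ltnNge; apply/negP => le_d; apply: not_unit.
have := sum_sqr_le_part12 sort_l; have := sum_sqr_le_part1 sort_m.
rewrite -hk sum_l => sqr_m sqr_l.
have le21 : part lambda 2 <= part lambda 1.
  by case: (lambda) sort_l => [|a [|b l]] //= /andP[].
(* Insert [sqr_l], [sqr_m] and the bound on [part mu 1] from [le_d] into [sqr_lm], and factor. By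
   [le21] the second factor is positive. *)
have : (k + 1 - part lambda 1) * (part lambda 1 - part lambda 2 + 1) <= 0.
  nia.
rewrite leqn0 muln_eq0 => /orP[|]; last by lia.
rewrite subn_eq0 => le_d1.
(* Having no zero terms, [lambda] then has a single term, so [2 * k + 1 <= k + 1] and only the unit
   pair remains. *)
have part2 : part lambda 2 = 0 by lia.
case: lambda nz_l sum_l part12 part2 le_d1
  {sort_l nef_lm sqr_lm le21 sqr_l le_d}.
  by rewrite big_nil addn1.
move=> a [|b l] /all_filterP /= /andP[_ nz_b].
  rewrite big_seq1 /part /= => sum_l part12 _ _.
  have [-> k0] : a = 1 /\ k = 0 by lia.
  case: mu hk nz_m {sort_m sqr_m} => // c mu.
  by rewrite k0 big_cons => hk /all_filterP /= /andP[]; lia.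
by move: nz_b => + _ _ part2; rewrite /part /= in part2; rewrite part2.
Qed.
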